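(* Let $\mathcal{H}\subset\{h=1\}\subset\mathbb{R}^n$ be a pseudo-Riemannian hypersurface of degree $d\ge2$ with basic polynomial $h$. If $\mathcal{H}$ is homogeneous under a subgroup $G\subset GL(n,\mathbb{R})\subset GL(n,\mathbb{C})$ (i.e. $G$ preserves $\mathcal{H}$ and acts transitively on it), then the associated tube domain $(U,g^c)$ is homogeneous as pseudo-Kähler manifold under the subgroup $$\hat G=\mathbb{R}^n\rtimes(\mathbb{R}^+\times G)\subset \mathrm{Aff}(\mathbb{C}^n)=\mathbb{C}^n\rtimes GL(n,\mathbb{C}),$$ i.e. $\hat G$ preserves $U$ and acts transitively on it by holomorphic isometries of $g^c$. Here $\mathbb{R}^n$ acts by real translations and $\mathbb{R}^+$ by scalar multiplication.
   Context: A hypersurface of degree $d\ge2$ with basic polynomial $h$ is a nonempty smooth, open and connected subset $\mathcal{H}$ of $\{X\in\mathbb{R}^n: h(X)=1\}$, where $h$ is a real homogeneous polynomial of degree $d$ which is not a power of a polynomial of lower degree. Let $H$ be the symmetric $d$-linear form with $h(X)=H(X,\dots,X)$. The canonical metric is $g_{X_0}(X,X)=-(d-1)H(X_0,\dots,X_0,X,X)$ for $X\in T_{X_0}\mathcal{H}$; $\mathcal{H}$ is pseudo-Riemannian if $g$ is nondegenerate. The associated tube domain is $U=\mathbb{R}^n+i\mathcal{V}\subset\mathbb{C}^n$, $\mathcal{V}=\mathbb{R}^+\cdot\mathcal{H}$, with coordinates $Z=X+iY$ and the canonical pseudo-Kähler metric $g^c=\sum_{i,j}\frac{\partial^2K}{\partial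 z^i\partial\bar z^j}dz^i\otimes d\bar z^j$, $K(Z)=-\frac4d\log h(Y)$. *)

(* Defs.v *)
From HB Require Import structures.
From mathcomp Require Import all_boot all_order all_algebra all_fingroup.
From mathcomp Require Import all_classical all_reals all_analysis.
From mathcomp Require Import complex.
(* The notations of mpoly clash with those of analysis. *)
From mathcomp Require mpoly.
Import -(notations) mpoly.

Set Implicit Arguments.
Unset Strict Implicit.
Unset Printing Implicit Defensive.

Import Order.TTheory GRing.Theory Num.Theory.
Import numFieldNormedType.Exports.

Local Open Scope classical_set_scope.
Local Open Scope ring_scope.
Local Open Scope complex_scope.

(* The usual topology and norm on R[i], so that 'cV[R[i]]_n is a normed module
   over R[i] and [differentiable] on it is complex differentiability. *)
HB.instance Definition _ (R : rcfType) :=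
  NormedModule.copy R[i] (R[i] : numFieldType)^o.

Section Hypersurfaces.
Variables (R : realType) (n d : nat).
Implicit Types (h : mpoly.mpoly n R) (S : set 'cV[R]_n) (X Y v : 'cV[R]_n).

Definition heval h X : R := mpoly.meval (fun i => X i ord0) h.

(* msize is the degree plus one, so [msize q <= d] says deg q < d. *)
Definition basic_polynomial h : Prop :=
  h \is @mpoly.ishomog1 n R d mpoly.mdeg /\
  ~ exists (q : mpoly.mpoly n R) (k : nat),
      (mpoly.msize q <= d)%N /\ h = q ^+ k.

Definition hypersurface h S : Prop :=
  [/\ basic_polynomial h,
      S !=set0,
      exists2 O : set 'cV[R]_n, open O & S = O `&` [set X | heval h X = 1],
      (* smoothness: S consists of regular points of h *)
      forall X, S X -> exists v, 'd (heval h) X v != 0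
    & connected S].

Definition tangent_space h X : set 'cV[R]_n := [set v | 'd (heval h) X v = 0].

Definition dform := {ffun 'I_d -> 'cV[R]_n} -> R.

Definition multilinear (H : dform) : Prop :=
  forall (x : {ffun 'I_d -> 'cV[R]_n}) (i : 'I_d) (a : R) u v,
    let x_ w := [ffun k => if k == i then w else x k] in
    H (x_ (a *: u + v)) = a * H (x_ u) + H (x_ v).

Definition symmetric_form (H : dform) : Prop :=
  forall (x : {ffun 'I_d -> 'cV[R]_n}) (s : 'S_d), H [ffun k => x (s k)] = H x.

Definition polarization h (H : dform) : Prop :=
  [/\ multilinear H, symmetric_form H &
      forall X, H [ffun _ => X] = heval h X].

(* - (d - 1) H(X0, ..., X0, X, Y): the bilinear form whose quadratic form is
   - (d - 1) H(X0, ..., X0, X, X). *)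
Definition canonical_metric (H : dform) X0 X Y : R :=
  - (d.-1)%:R *
  H [ffun k : 'I_d => if k.+2 == d then X else if k.+1 == d then Y else X0].

Definition pseudo_riemannian h (H : dform) S : Prop :=
  forall X0, S X0 -> forall X, tangent_space h X0 X ->
    (forall Y, tangent_space h X0 Y -> canonical_metric H X0 X Y = 0) ->
    X = 0.

Definition GL_subgroup (G : set 'M[R]_n) : Prop :=
  [/\ forall A, G A -> A \in unitmx,
      G 1%:M,
      forall A B, G A -> G B -> G (A *m B)
    & forall A, G A -> G (invmx A)].

Definition homogeneous_under (G : set 'M[R]_n) S : Prop :=
  (forall A, G A -> mulmx A @` S = S) /\
  (forall X Y, S X -> S Y -> exists2 A, G A & A *m X = Y).

Definition cone S : set 'cV[R]_n :=
  [set Y | exists2 t : R, 0 < t & exists2 X, S X & Y = t *: X].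

End Hypersurfaces.

Section ComplexSpace.
Variables (R : realType) (n : nat).
Local Notation Cn := 'cV[R[i]]_n.
Implicit Types (U : set Cn) (Z V W : Cn).

(* Derivative at Z of a real-valued function on C^n = R^2n, in the real
   direction V. *)
Definition rder V (f : Cn -> R) Z : R :=
  derive1 (fun t : R => f (Z + t%:C *: V)) 0.

Definition cder V (F : Cn -> R[i]) Z : R[i] :=
  rder V (fun Z' => complex.Re (F Z')) Z +i*
  rder V (fun Z' => complex.Im (F Z')) Z.

Definition evec (j : 'I_n) : Cn := delta_mx j ord0.

(* Wirtinger derivatives d/dz^j and d/dzbar^j *)
Definition wirtinger (j : 'I_n) (F : Cn -> R[i]) Z : R[i] :=
  (cder (evec j) F Z - 'i * cder ('i *: evec j) F Z) / 2%:R.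

Definition wirtinger_bar (j : 'I_n) (F : Cn -> R[i]) Z : R[i] :=
  (cder (evec j) F Z + 'i * cder ('i *: evec j) F Z) / 2%:R.

Fixpoint C_k (k : nat) U (f : Cn -> R) : Prop :=
  (forall Z, U Z -> {for Z, continuous f}) /\
  if k is k'.+1 then
    forall V, (forall Z, U Z -> derivable (fun t : R => f (Z + t%:C *: V)) 0 1)
              /\ C_k k' U (rder V f)
  else True.

Definition smooth_on U (F : Cn -> R[i]) : Prop :=
  forall k, C_k k U (fun Z => complex.Re (F Z)) /\
            C_k k U (fun Z => complex.Im (F Z)).

(* A matrix-valued function g stands for the tensor
   sum_(i, j) g_ij dz^i (x) dzbar^j. *)
Definition hermitian_tensor (A : 'M[R[i]]_n) V W : R[i] :=
  \sum_i \sum_j A i j * V i ord0 * (W j ord0)^*.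

(* For Hermitian g, the form (i/2) sum g_ij dz^i /\ dzbar^j is closed iff
   d g_ij / dz^k = d g_kj / dz^i for all i, j, k. *)
Definition pseudo_kahler U (g : Cn -> 'M[R[i]]_n) : Prop :=
  [/\ open U,
      forall i j, smooth_on U (fun Z => g Z i j),
      forall Z, U Z -> forall i j, g Z j i = (g Z i j)^*,
      forall Z, U Z -> forall V,
        (forall W, hermitian_tensor (g Z) V W = 0) -> V = 0
    & forall Z, U Z -> forall i j k,
        wirtinger k (fun Z' => g Z' i j) Z = wirtinger i (fun Z' => g Z' k j) Z].

Definition holomorphic_isometry U (g : Cn -> 'M[R[i]]_n) (F : Cn -> Cn) : Prop :=
  [/\ set_bij U U F,
      forall Z, U Z -> differentiable F Z
    & forall Z, U Z -> forall V W,
        hermitian_tensor (g (F Z)) ('d F Z V) ('d F Z W) =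
        hermitian_tensor (g Z) V W].

(* (b, A) is the affine map Z |-> A Z + b. *)
Definition affine : Type := (Cn * 'M[R[i]]_n)%type.

Definition aff_act (a : affine) Z : Cn := a.2 *m Z + a.1.

Definition aff_subgroup (L : set affine) : Prop :=
  [/\ forall a, L a -> a.2 \in unitmx,
      L (0, 1%:M),
      forall a b, L a -> L b -> L (a.1 + a.2 *m b.1, a.2 *m b.2)
    & forall a, L a -> L (- (invmx a.2 *m a.1), invmx a.2)].

Definition homogeneous_pseudo_kahler U (g : Cn -> 'M[R[i]]_n)
    (L : set affine) : Prop :=
  [/\ pseudo_kahler U g,
      aff_subgroup L,
      forall a, L a -> holomorphic_isometry U g (aff_act a)
    & forall Z W, U Z -> U W -> exists2 a, L a & aff_act a Z = W].

End ComplexSpace.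

Section Tube.
Variables (R : realType) (n : nat).

Definition tube (S : set 'cV[R]_n) : set 'cV[R[i]]_n :=
  [set Z | cone S (map_mx (@complex.Im R) Z)].

Definition kahler_potential (d : nat) (h : mpoly.mpoly n R)
    (Z : 'cV[R[i]]_n) : R :=
  - (4%:R / d%:R) * ln (heval h (map_mx (@complex.Im R) Z)).

Definition tube_metric (d : nat) (h : mpoly.mpoly n R)
    (Z : 'cV[R[i]]_n) : 'M[R[i]]_n :=
  \matrix_(i, j)
    wirtinger i (wirtinger_bar j (fun Z' => (kahler_potential d h Z')%:C)) Z.

(* (b, t, A) in R^n x| (R^+ x G) is the affine map Z |-> t A Z + b. *)
Definition hat_elt (p : 'cV[R]_n * (R * 'M[R]_n)) : affine R n :=
  (map_mx (real_complex R) p.1, p.2.1%:C *: map_mx (real_complex R) p.2.2).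

Definition hat_param (G : set 'M[R]_n) : set ('cV[R]_n * (R * 'M[R]_n)) :=
  [set p | 0 < p.2.1 /\ G p.2.2].

Definition hat_group (G : set 'M[R]_n) : set (affine R n) :=
  hat_elt @` hat_param G.

End Tube.

(* Main.v *)
(* On the tube domain the potential depends on the imaginary part Y only, so the
   metric at Z is the real matrix -(1/d) Hess (log h)(Y), one quarter of the
   Hessian of the potential.  Its entries are quotients of polynomials by powers
   of h, hence smooth, and it is Kaehler because third derivatives of log h are
   symmetric.  At X in S, Euler's identities give
   Hess (log h)(v, X) = - dh(v), so a vector v in the kernel of the metric is
   tangent to S; on tangent vectors the metric is the canonical metric of S,
   which is nondegenerate.  An element t A of R^+ x G multiplies h by t^d on the
   cone, which changes the potential by a constant, so it acts by isometries.
   Transitivity combines that of G on S with dilations and real translations. *)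
Require Import Defs.
From mathcomp Require Import all_boot all_order all_algebra.
From mathcomp Require Import all_classical all_reals all_analysis.
From mathcomp Require mpoly.
Import -(notations) mpoly.
From mathcomp Require Import all_fingroup complex ring.
Import Order.TTheory GRing.Theory Num.Theory.
Import numFieldNormedType.Exports.

Set Implicit Arguments.
Unset Strict Implicit.
Unset Printing Implicit Defensive.

Local Open Scope classical_set_scope.
Local Open Scope ring_scope.

(** * Directional derivatives of polynomials, formal and analytic *)

Section DirectionalDerivatives.
Variables (R : realType) (n : nat).
Implicit Types (p q h : mpoly.mpoly n R) (X Y u v w : 'cV[R]_n).

(** The derivative stays a polynomial, so that product rules and the exchange of derivatives are
    identities in a commutative ring, within reach of [ring]. *)
Definition dirderiv v p : mpoly.mpoly n R :=
  \sum_i v i ord0 *: mderiv i p.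

Lemma dirderivD v p q : dirderiv v (p + q) = dirderiv v p + dirderiv v q.
Proof.
by rewrite /dirderiv -big_split /=; apply: eq_bigr => i _; rewrite mderivD scalerDr.
Qed.

Lemma dirderivZ v a p : dirderiv v (a *: p) = a *: dirderiv v p.
Proof.
rewrite /dirderiv scaler_sumr; apply: eq_bigr => i _.
by rewrite mderivZ !scalerA mulrC.
Qed.

Lemma dirderivN v p : dirderiv v (- p) = - dirderiv v p.
Proof. by rewrite -scaleN1r dirderivZ scaleN1r. Qed.

Lemma dirderivM v p q :
  dirderiv v (p * q) = dirderiv v p * q + p * dirderiv v q.
Proof.
rewrite /dirderiv mulr_suml mulr_sumr -big_split /=; apply: eq_bigr => i _.
by rewrite mderivM scalerDr scalerAl scalerAr.
Qed.

Lemma dirderivC v c : dirderiv v (mpolyC n c) = 0.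
Proof. by rewrite /dirderiv big1// => i _; rewrite mderivC scaler0. Qed.

Lemma dirderivU v i : dirderiv v (mpolyX R (mnm1 i)) = mpolyC n (v i ord0).
Proof.
rewrite /dirderiv (bigD1 i)//= big1 ?addr0 => [|j ji].
  rewrite mderivX mnm1E eqxx scale1r.
  have -> : mnm_sub (mnm1 i) (mnm1 i) = mnm0 by apply/mnmP => k; rewrite mnmBE mnm0E subnn.
  by rewrite mpolyX0 -alg_mpolyC.
by rewrite mderivX mnm1E eq_sym (negbTE ji) scale0r scaler0.
Qed.

Lemma dirderiv_comm v w p :
  dirderiv v (dirderiv w p) = dirderiv w (dirderiv v p).
Proof.
have mdsum i (F : 'I_n -> mpoly.mpoly n R) :
  mderiv i (\sum_j F j) = \sum_j mderiv i (F j) by rewrite raddf_sum.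
rewrite /dirderiv.
under eq_bigr => i _ do rewrite mdsum scaler_sumr.
under [RHS]eq_bigr => i _ do rewrite mdsum scaler_sumr.
rewrite exchange_big /=; apply: eq_bigr => i _; apply: eq_bigr => j _.
by rewrite !mderivZ !scalerA mulrC mderiv_comm.
Qed.

Lemma heval_dirderiv v p Y :
  heval (dirderiv v p) Y = \sum_i v i ord0 * heval (mderiv i p) Y.
Proof.
rewrite /heval /dirderiv raddf_sum; apply: eq_bigr => i _; exact: mevalZ.
Qed.

(** The property carried through the induction on polynomials: the formal derivative computes the
    analytic one, and full differentiability comes along. *)
Definition has_dirderiv p := forall Y,
  differentiable (heval p) Y /\
  forall v, is_derive Y v (heval p) (heval (dirderiv v p) Y).

Lemma has_dirderivM p q : has_dirderiv p -> has_dirderiv q -> has_dirderiv (p * q).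
Proof.
have E : heval (p * q) = heval p * heval q.
  by apply/funext => Y; rewrite /heval mevalM.
move=> cp cq Y; have [dp Dp] := cp Y; have [dq Dq] := cq Y.
split; first by rewrite E; exact: differentiableM.
move=> v; rewrite E; apply: is_derive_eq.
by rewrite dirderivM /heval mevalD !mevalM /GRing.scale /= addrC mulrC.
Qed.

Lemma has_dirderivC c : has_dirderiv (mpolyC n c).
Proof.
have E : heval (mpolyC n c) = cst c.
  by apply/funext => Y; rewrite /heval mevalC.
move=> Y; split; first by rewrite E; exact: differentiable_cst.
move=> v; rewrite E dirderivC.
by apply: is_derive_eq; rewrite /heval meval0.
Qed.

Lemma has_dirderivU i : has_dirderiv (mpolyX R (mnm1 i)).
Proof.
have E : heval (mpolyX R (mnm1 i)) = (fun Y : 'cV[R]_n => Y i ord0).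
  by apply/funext => Y; rewrite /heval mevalXU.
move=> Y; rewrite E; split; first exact: differentiable_coord.
move=> v; apply: DeriveDef.
  by apply: diff_derivable; exact: differentiable_coord.
rewrite dirderivU /heval mevalC /derive.
apply: lim_near_cst => //.
near=> t.
rewrite /= !mxE addrK /GRing.scale /= mulrA mulVf ?mul1r//.
by near: t; exact: nbhs_dnbhs_neq.
Unshelve. all: by end_near. Qed.

(** Constants and variables have the property and products keep it, which covers the monomials; a
    polynomial is then reached by adding one term at a time. *)
Lemma has_dirderiv_heval p : has_dirderiv p.
Proof.
elim/mpolyind: p => [|c m p _ _ cp].
  by rewrite -mpolyC0; exact: has_dirderivC.
have cX : has_dirderiv (mpolyX R m).
  rewrite mpolyXE_id; apply: big_ind.
  - exact: has_dirderivC.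
  - exact: has_dirderivM.
  - move=> i _; elim: (m i) => [|k IHk]; first exact: has_dirderivC.
    by rewrite exprS; apply: has_dirderivM => //; exact: has_dirderivU.
have ccX : has_dirderiv (c *: mpolyX R m).
  by rewrite -mul_mpolyC; apply: has_dirderivM => //; exact: has_dirderivC.
have E : heval (c *: mpolyX R m + p) = heval (c *: mpolyX R m) + heval p.
  by apply/funext => Y; rewrite /heval mevalD.
move=> Y; have [d1 D1] := ccX Y; have [d2 D2] := cp Y.
split; first by rewrite E; exact: differentiableD.
by move=> v; rewrite E; apply: is_derive_eq; rewrite dirderivD /heval mevalD.
Qed.

Lemma differentiable_heval p Y : differentiable (heval p) Y.
Proof. by have [] := has_dirderiv_heval p Y. Qed.

Lemma is_derive_heval v p Y :
  is_derive Y v (heval p) (heval (dirderiv v p) Y).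
Proof. by have [_] := has_dirderiv_heval p Y. Qed.

Lemma diff_heval v p Y : 'd (heval p) Y v = heval (dirderiv v p) Y.
Proof.
rewrite -deriveE; last exact: differentiable_heval.
by have := is_derive_heval v p Y => D; rewrite derive_val.
Qed.

Lemma continuous_heval p : continuous (heval p : 'cV[R]_n -> R).
Proof. by move=> Y; apply: differentiable_continuous; exact: differentiable_heval. Qed.

(* These quotients are closed under directional derivatives, which gives the
   smoothness of the metric. *)
Definition hquot h p k Y : R := heval p Y / heval h Y ^+ k.

(** The quotient rule after cancelling the common power of [h]: the exponent grows by one only, and
    the result has the same shape again. *)
Lemma is_derive_hquot v h p k Y : heval h Y != 0 ->
  is_derive Y v (hquot h p k)
   (hquot h (dirderiv v p * h - p * dirderiv v h *+ k) k.+1 Y).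
Proof.
move=> h0.
have Dp := is_derive_heval v p Y; have Dh := is_derive_heval v h Y.
pose hk X := heval h X ^+ k.
have hk0 : hk Y != 0 by rewrite expf_neq0.
have hkE : heval h ^+ k = hk :> ('cV[R]_n -> R) by exact: exprfctE.
have Dk : is_derive Y v hk ((k%:R * heval h Y ^+ k.-1) *: heval (dirderiv v h) Y).
  by rewrite -hkE; exact: is_deriveX.
have -> : hquot h p k = heval p * (fun X => (hk X)^-1) by [].
have DV : is_derive Y v (fun X => (hk X)^-1)
   (- (hk Y) ^- 2 *: ((k%:R * heval h Y ^+ k.-1) *: heval (dirderiv v h) Y)).
  have [dk Ek] := Dk.
  by apply: DeriveDef; [exact: (derivableV hk0 dk)|rewrite (deriveV hk0 dk) Ek].
apply: is_derive_eq.
rewrite /hquot /heval mevalB mevalMn !mevalM -!/(heval _ _) /GRing.scale /=.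
(* The power rule produces [k.-1], so the exponent zero is treated apart before [field]. *)
rewrite /hk; case: k {hk hk0 hkE Dk DV} => [|k] /=.
  by rewrite !mul0r !mulr0 mulr0n subr0 expr0 expr1; field.
rewrite -mulr_natl !exprS; field.
by rewrite h0 expf_neq0.
Qed.

(** [rder] differentiates along a real line; this translates such derivatives into directional
    ones. *)
Lemma derive_line (f : 'cV[R]_n -> R) v Y :
  derive1 (fun t : R => f (Y + t *: v)) 0 = 'D_v f Y.
Proof.
rewrite /derive1 /derive.
set g1 := fun t => t^-1 *: _; set g2 := fun t => t^-1 *: _.
suff -> : g1 = g2 by [].
by apply/funext => t; rewrite /g1 /g2 /= addr0 scale0r addr0 [Y + _]addrC.
Qed.

Lemma derivable_line (f : 'cV[R]_n -> R) v Y :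
  derivable (fun t : R => f (Y + t *: v)) 0 1 <-> derivable f Y v.
Proof.
suff -> : (fun t : R => f (Y + t *: v)) = (fun t : R => f (t *: v + Y)).
  exact: iff_sym (derivable1P _ _ _).
by apply/funext => t; rewrite addrC.
Qed.

Lemma is_derive_line (f : 'cV[R]_n -> R) v Y c :
  is_derive (0 : R) 1 (fun t : R => f (Y + t *: v)) c <-> is_derive Y v f c.
Proof.
split => -[D E]; apply: DeriveDef.
- exact/derivable_line.
- by rewrite -derive_line derive1E.
- exact/derivable_line.
- by rewrite -derive1E derive_line.
Qed.

Lemma is_derive_ln_heval v h Y : 0 < heval h Y ->
  is_derive Y v (fun X => ln (heval h X)) (hquot h (dirderiv v h) 1 Y).
Proof.
move=> h0; apply/is_derive_line.
have /is_derive_line Dh := is_derive_heval v h Y.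
have Dl : is_derive (heval h (Y + (0 : R) *: v)) 1 (@ln R) (heval h Y)^-1.
  by rewrite scale0r addr0; exact: is_derive1_ln.
have := is_derive1_comp Dl Dh.
by rewrite /hquot expr1 mulrC.
Qed.

End DirectionalDerivatives.

(** * Derivatives of [h] through its polarization *)

Section Polarization.
Variables (R : realType) (n d : nat) (H : dform R n d).
Hypothesis mulH : multilinear H.
Implicit Types (X Y v w : 'cV[R]_n) (x y : {ffun 'I_d -> 'cV[R]_n}) (k : 'I_d).

Definition fupd x k w : {ffun 'I_d -> 'cV[R]_n} :=
  [ffun j => if j == k then w else x j].

Lemma multilinearD x k (a : R) u v :
  H (fupd x k (a *: u + v)) = a * H (fupd x k u) + H (fupd x k v).
Proof. exact: mulH. Qed.

Lemma multilinear0 x k : H (fupd x k 0) = 0.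
Proof.
have := multilinearD x k (- 1) 0 0.
by rewrite scaler0 addr0 mulN1r addNr.
Qed.

Lemma multilinearZ x k (a : R) u :
  H (fupd x k (a *: u)) = a * H (fupd x k u).
Proof. by rewrite -[a *: u]addr0 multilinearD multilinear0 addr0. Qed.

(** The slots listed in [s] move one after the other: linearity in the first of them splits the
    function, and induction on [s] handles the rest. *)
Lemma is_derive_multilinear (s : seq 'I_d) x y : uniq s ->
  is_derive (0 : R) 1
    (fun t : R => H [ffun k => if k \in s then x k + t *: y k else x k])
    (\sum_(k <- s) H (fupd x k (y k))).
Proof.
elim: s x => [x _|k0 s IHs x /= /andP[k0s us]].
  rewrite big_nil.
  have -> : (fun t : R => H [ffun k => if k \in [::] then x k + t *: y k else x k])
      = cst (H x).
    by apply/funext => t; congr H; apply/ffunP => k; rewrite ffunE.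
  exact: is_derive_cst.
pose F x (t : R) := H [ffun k => if k \in s then x k + t *: y k else x k].
have F0 z : F z 0 = H z.
  rewrite /F; congr H; apply/ffunP => k; rewrite ffunE scale0r addr0.
  by case: ifP.
(* The slot [k0] contributes [t] times a function of [t]; at 0 the product rule leaves only the
   value of that function. *)
have -> : (fun t : R =>
    H [ffun k => if k \in k0 :: s then x k + t *: y k else x k]) =
    id * F (fupd x k0 (y k0)) + F x.
  apply/funext => t; rewrite [RHS]/(t * F (fupd x k0 (y k0)) t + F x t).
  pose b := [ffun k => if k \in s then x k + t *: y k else x k].
  have -> : F x t = H (fupd b k0 (x k0)).
    congr H; apply/ffunP => k; rewrite !ffunE.
    by case: eqP => [->|//]; rewrite (negbTE k0s).
  have -> : F (fupd x k0 (y k0)) t = H (fupd b k0 (y k0)).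
    congr H; apply/ffunP => k; rewrite !ffunE.
    by case: eqP => [->|//]; rewrite (negbTE k0s).
  transitivity (H (fupd b k0 (t *: y k0 + x k0))); last exact: multilinearD.
  congr H; apply/ffunP => k; rewrite !ffunE inE.
  by case: eqP => [->|//]; rewrite addrC.
have D1 := IHs x us; have D2 := IHs (fupd x k0 (y k0)) us.
apply: is_derive_eq.
by rewrite big_cons scale0r add0r F0 [_%:A]mulr1.
Qed.

Lemma multilinear_homog (s : seq 'I_d) x (t : R) : uniq s ->
  H [ffun k => if k \in s then t *: x k else x k] = t ^+ size s * H x.
Proof.
elim: s => [_|k0 s IHs /= /andP[k0s us]].
  by rewrite mul1r; congr H; apply/ffunP => k; rewrite ffunE.
rewrite exprS -mulrA -IHs//.
set b := [ffun k => if k \in s then _ else _].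
have -> : [ffun k => if k \in k0 :: s then t *: x k else x k] = fupd b k0 (t *: x k0).
  by apply/ffunP => k; rewrite !ffunE inE; case: eqP => [->|].
rewrite multilinearZ; congr (_ * H _); apply/ffunP => k; rewrite !ffunE.
by case: eqP => [->|//]; rewrite (negbTE k0s).
Qed.

Hypothesis symH : Defs.symmetric_form H.

(** Transposing [k] and [k0] moves the exceptional slot, all the others holding [X]. *)
Lemma symmetric_fupd X k0 k w :
  H (fupd [ffun=> X] k w) = H (fupd [ffun=> X] k0 w).
Proof.
rewrite -(symH _ (tperm k k0)); congr H; apply/ffunP => j; rewrite !ffunE.
by rewrite (canF_eq (tpermK k k0)) tpermL.
Qed.

Lemma symmetric_fupd2 X k0 k1 k v w : k1 != k0 -> k != k0 ->
  H (fupd (fupd [ffun=> X] k0 w) k v) = H (fupd (fupd [ffun=> X] k0 w) k1 v).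
Proof.
move=> k10 kk0.
rewrite -(symH _ (tperm k k1)); congr H; apply/ffunP => j; rewrite !ffunE.
by rewrite !(canF_eq (tpermK k k1)) tpermL tpermD.
Qed.

Variable h : mpoly.mpoly n R.
Hypothesis hH : forall X, H [ffun=> X] = heval h X.

Lemma heval_homog (t : R) X : heval h (t *: X) = t ^+ d * heval h X.
Proof.
rewrite -!hH -[d in t ^+ d]card_ord cardE -multilinear_homog ?enum_uniq//.
by congr H; apply/ffunP => k; rewrite !ffunE mem_enum.
Qed.

(** In H(X + tw, ..., X + tw) each of the [d] slots yields one term, and symmetry makes these terms
    equal. *)
Lemma heval_dirderiv1 k0 X w :
  heval (dirderiv w h) X = d%:R * H (fupd [ffun=> X] k0 w).
Proof.
have [_ <-] := is_derive_heval w h X.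
have /is_derive_line[_ ->] : is_derive (0 : R) 1
    (fun t : R => heval h (X + t *: w)) (\sum_(k <- enum 'I_d) H (fupd [ffun=> X] k w)).
  have := is_derive_multilinear [ffun=> X] [ffun=> w] (enum_uniq 'I_d).
  under eq_bigr => k _ do rewrite ffunE.
  rewrite (_ : (fun t : R => _) = (fun t : R => heval h (X + t *: w)))//.
  apply/funext => t; rewrite -hH; congr H; apply/ffunP => k.
  by rewrite !ffunE mem_enum.
under eq_bigr => k _ do rewrite (symmetric_fupd X k0).
by rewrite big_const_seq count_predT -cardE card_ord iter_addr_0 mulr_natl.
Qed.

Lemma heval_dirderiv2 k0 k1 X v w : k1 != k0 ->
  heval (dirderiv v (dirderiv w h)) X =
  (d * d.-1)%:R * H (fupd (fupd [ffun=> X] k0 w) k1 v).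
Proof.
move=> k10.
have [_ <-] := is_derive_heval v (dirderiv w h) X.
(* The formula for the first derivative is differentiated with the slot [k0] frozen at [w]; the
   other [d.-1] slots move. *)
have D : is_derive (0 : R) 1
    (fun t : R => H (fupd [ffun=> X + t *: v] k0 w))
    (\sum_(k <- enum (predC1 k0)) H (fupd (fupd [ffun=> X] k0 w) k v)).
  have := is_derive_multilinear (fupd [ffun=> X] k0 w) [ffun=> v] (enum_uniq (predC1 k0)).
  under eq_bigr => k _ do rewrite ffunE.
  rewrite (_ : (fun t : R => _) = (fun t : R => H (fupd [ffun=> X + t *: v] k0 w)))//.
  apply/funext => t; congr H; apply/ffunP => k.
  by rewrite !ffunE mem_enum inE; case: eqP.
have /is_derive_line[_ ->] : is_derive (0 : R) 1
    (fun t : R => heval (dirderiv w h) (X + t *: v))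
    (d%:R * \sum_(k <- enum (predC1 k0)) H (fupd (fupd [ffun=> X] k0 w) k v)).
  rewrite (_ : (fun t : R => _) = d%:R \*: (fun t : R => H (fupd [ffun=> X + t *: v] k0 w))).
    exact: is_deriveZ.
  by apply/funext => t; rewrite (heval_dirderiv1 k0).
rewrite natrM -mulrA; congr (_ * _).
rewrite (eq_big_seq (fun=> H (fupd (fupd [ffun=> X] k0 w) k1 v))).
  rewrite big_const_seq count_predT -cardE iter_addr_0 mulr_natl.
  by rewrite cardC1 card_ord.
by move=> k; rewrite mem_enum => kk0; exact: symmetric_fupd2.
Qed.

End Polarization.

(** * The Hessian of the logarithm of [h] *)

Section LogHessian.
Variables (R : realType) (n d : nat) (h : mpoly.mpoly n R).
Implicit Types (X Y u v w : 'cV[R]_n).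

Definition log_potential Y : R := - (4%:R / d%:R) * ln (heval h Y).

(* The numerator, over h ^+ 2, of -(1/d) D_v D_w (ln h). *)
Definition log_hess_num v w : mpoly.mpoly n R :=
  - d%:R^-1 *:
  (dirderiv v (dirderiv w h) * h - dirderiv w h * dirderiv v h).

Definition log_hess v w Y : R := hquot h (log_hess_num v w) 2 Y.

Lemma log_hess_numC v w : log_hess_num v w = log_hess_num w v.
Proof. by rewrite /log_hess_num dirderiv_comm [_ * dirderiv v h]mulrC. Qed.

Lemma log_hessC v w Y : log_hess v w Y = log_hess w v Y.
Proof. by rewrite /log_hess log_hess_numC. Qed.

Lemma near_heval_gt0 Y : 0 < heval h Y -> \forall X \near Y, 0 < heval h X.
Proof. by apply: (cvgr_gt _ (@continuous_heval _ _ h Y)). Qed.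

Lemma is_derive_log_potential w Y : 0 < heval h Y ->
  is_derive Y w log_potential (hquot h (- (4%:R / d%:R) *: dirderiv w h) 1 Y).
Proof.
move=> h0; have D := is_derive_ln_heval w h0.
have -> : log_potential = - (4%:R / d%:R) \*: (fun X => ln (heval h X)) by [].
apply: is_derive_eq.
by rewrite /hquot /heval mevalZ /GRing.scale /= mulrA.
Qed.

(** The factor 4 is the one that the two halves in the Wirtinger derivatives absorb later. *)
Lemma is_derive2_log_potential v w Y : 0 < heval h Y ->
  is_derive Y v ('D_w log_potential) (4%:R * log_hess v w Y).
Proof.
move=> h0.
have D := is_derive_hquot v (- (4%:R / d%:R) *: dirderiv w h) 1 (lt0r_neq0 h0).
apply: (@near_eq_is_derive _ _ _ (hquot h (- (4%:R / d%:R) *: dirderiv w h) 1)).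
  apply: filterS (near_heval_gt0 h0) => X X0.
  by have [_ ->] := is_derive_log_potential w X0.
apply: is_derive_eq.
rewrite /log_hess /hquot mulr1n mulrA; congr (_ / _).
rewrite /log_hess_num /heval mevalZ !mevalB !mevalM dirderivZ !mevalZ.
by rewrite -!/(heval _ _); ring.
Qed.

Lemma is_derive_log_hess u v w Y : heval h Y != 0 ->
  is_derive Y u (log_hess v w)
    (hquot h (dirderiv u (log_hess_num v w) * h
              - log_hess_num v w * dirderiv u h *+ 2) 3 Y).
Proof. exact: is_derive_hquot. Qed.

(** The symmetry of third derivatives behind the Kaehler condition; it reduces to an identity
    between numerators over the same power of [h]. *)
Lemma derive_log_hessC u v w Y : heval h Y != 0 ->
  'D_u (log_hess v w) Y = 'D_v (log_hess u w) Y.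
Proof.
move=> h0.
have [_ ->] := is_derive_log_hess u v w h0.
have [_ ->] := is_derive_log_hess v u w h0.
congr (hquot _ _ _ _).
rewrite /log_hess_num !dirderivZ !dirderivD !dirderivN !dirderivM.
rewrite -!scalerAl !scalerMnr -!scalerBr; congr (_ *: _).
by rewrite (dirderiv_comm v u (dirderiv w h)) (dirderiv_comm v u h); ring.
Qed.

Lemma dirderiv_delta i (p : mpoly.mpoly n R) : dirderiv (delta_mx i ord0) p = mderiv i p.
Proof.
rewrite /dirderiv (bigD1 i)//= big1 ?addr0 => [|j ji].
  by rewrite !mxE !eqxx scale1r.
by rewrite !mxE (negbTE ji) scale0r.
Qed.

Lemma log_hess_suml v w Y :
  log_hess v w Y = \sum_i v i ord0 * log_hess (delta_mx i ord0) w Y.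
Proof.
rewrite /log_hess /hquot /log_hess_num /heval.
under eq_bigr => i _ do rewrite mevalZ !mevalB !mevalM -!/(heval _ _) !dirderiv_delta.
rewrite mevalZ !mevalB !mevalM -!/(heval _ _) !heval_dirderiv.
under [RHS]eq_bigr => i _ do rewrite mulrA.
rewrite -mulr_suml; congr (_ / _).
under [RHS]eq_bigr => i _ do rewrite mulrCA.
rewrite -mulr_sumr; congr (_ * _).
rewrite mulr_suml mulr_sumr -sumrB; apply: eq_bigr => i _.
by rewrite mulrBr !mulrA; congr (_ - _); rewrite mulrAC mulrC !mulrA.
Qed.

Definition log_hess_mx Y : 'M[R]_n :=
  \matrix_(i, j) log_hess (delta_mx i ord0) (delta_mx j ord0) Y.

Lemma log_hessE v w Y : log_hess v w Y = (v^T *m log_hess_mx Y *m w) ord0 ord0.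
Proof.
rewrite -mulmxA mxE log_hess_suml; apply: eq_bigr => i _.
rewrite !mxE log_hessC log_hess_suml; congr (_ * _); apply: eq_bigr => j _.
by rewrite mxE log_hessC mulrC.
Qed.

Lemma derive_mulmx (f : 'cV[R]_n -> R) (A : 'M[R]_n) v Y :
  'D_(A *m v) f (A *m Y) = 'D_v (f \o mulmx A) Y.
Proof.
rewrite -!derive_line; congr (derive1 _ 0); apply/funext => t /=.
by rewrite mulmxDr -scalemxAr.
Qed.

(** Multiplying [h] by [c] adds a constant to the potential, so first derivatives correspond under
    [A]. They do so on the whole open set [C], which permits a second differentiation. *)
Lemma log_hess_invariant (C : set 'cV[R]_n) (A : 'M[R]_n) (c : R) :
  open C -> 0 < c -> (forall Y, C Y -> C (A *m Y)) ->
  (forall Y, C Y -> 0 < heval h Y) ->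
  (forall Y, C Y -> heval h (A *m Y) = c * heval h Y) ->
  forall v w Y, C Y -> log_hess (A *m v) (A *m w) (A *m Y) = log_hess v w Y.
Proof.
move=> oC c0 AC C0 hA v w.
have D1 u Y : C Y -> 'D_(A *m u) log_potential (A *m Y) = 'D_u log_potential Y.
  move=> CY; rewrite derive_mulmx.
  have D := is_derive_log_potential u (C0 _ CY).
  transitivity ('D_u (log_potential + cst (- (4%:R / d%:R) * ln c)) Y).
    apply: near_eq_derive; have := open_nbhs_nbhs (conj oC CY).
    apply: filterS => X CX /=; rewrite fctE /log_potential hA// lnM ?posrE//; last exact: C0.
    by rewrite mulrDr addrC.
  have D' : is_derive Y u (log_potential + cst (- (4%:R / d%:R) * ln c))
    (hquot h (- (4%:R / d%:R) *: dirderiv u h) 1 Y + 0) by exact: is_deriveD.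
  by case: D' => _ ->; case: D => _ ->; rewrite addr0.
move=> Y CY.
have D2 : 'D_(A *m v) ('D_(A *m w) log_potential) (A *m Y) = 'D_v ('D_w log_potential) Y.
  transitivity ('D_v ('D_(A *m w) log_potential \o mulmx A) Y); first exact: derive_mulmx.
  apply: (@near_eq_derive _ _ _ ('D_(A *m w) log_potential \o mulmx A) ('D_w log_potential)).
  by have := open_nbhs_nbhs (conj oC CY); apply: filterS => X CX; exact: D1.
have [_ E1] := is_derive2_log_potential (A *m v) (A *m w) (C0 _ (AC _ CY)).
have [_ E2] := is_derive2_log_potential v w (C0 _ CY).
have four0 : 4%:R != 0 :> R by rewrite pnatr_eq0.
exact: (mulfI four0 (etrans (esym E1) (etrans D2 E2))).
Qed.

End LogHessian.

(** * The open cone over the hypersurface *)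

Section Cone.
Variables (R : realType) (n d : nat) (h : mpoly.mpoly n R) (S : set 'cV[R]_n).
Implicit Types (X Y u v w : 'cV[R]_n).
Hypothesis d_gt0 : (0 < d)%N.
Hypothesis h_homog : forall (t : R) X, heval h (t *: X) = t ^+ d * heval h X.
Hypothesis hS : forall X, S X -> heval h X = 1.

Lemma cone_heval_gt0 Y : cone S Y -> 0 < heval h Y.
Proof.
move=> [t t0 [X SX ->]]; rewrite h_homog hS// mulr1; exact: exprn_gt0.
Qed.

Lemma sub_cone : S `<=` cone S.
Proof. by move=> X SX; exists 1 => //; exists X; rewrite ?scale1r. Qed.

(** The cone is described by two open conditions: [h] is positive, and the radial projection to the
    level set lands in [O]. *)
Lemma open_cone (O : set 'cV[R]_n) :
  open O -> S = O `&` [set X | heval h X = 1] -> open (cone S).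
Proof.
move=> oO SE.
(* This is h(Y) to the power -1/d, the factor that rescales [Y] to a point where [h] equals 1. *)
pose r Y : R := expR (- (d%:R^-1 * ln (heval h Y))).
have rE Y : 0 < heval h Y -> r Y ^+ d * heval h Y = 1.
  move=> h0; rewrite /r -expRM_natl mulrN mulrA mulfV ?pnatr_eq0 -?lt0n// mul1r.
  by rewrite expRN lnK ?posrE// mulVf// gt_eqF.
have cr Y : 0 < heval h Y -> {for Y, continuous r}.
  move=> h0; apply: continuous_comp; last exact: continuous_expR.
  have cl : {for Y, continuous (@ln R \o heval h)}.
    apply: continuous_comp; first exact: continuous_heval.
    exact: continuous_ln.
  apply: continuousN; exact: (@cvgMl_tmp _ _ _ _ _ _ _ cl).
have -> : cone S = [set Y | 0 < heval h Y /\ O (r Y *: Y)].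
  apply/seteqP; split => [Y cY|Y [h0 OY]].
    have h0 := cone_heval_gt0 cY; split => //.
    have [t t0 [X SX YE]] := cY.
    suff -> : r Y *: Y = X by move: SX; rewrite SE => -[].
    (* Since h(Y) = t^d, the nonnegative number [r Y * t] has [d]-th power 1 and is therefore 1. *)
    have : (r Y * t) ^+ d = 1.
      by rewrite exprMn -(rE _ h0) {3}YE h_homog (hS SX) mulr1.
    move/eqP; rewrite pexpr_eq1 ?mulr_ge0 ?expR_ge0 ?ltW// => /eqP rt.
    by rewrite YE scalerA -YE rt scale1r.
  exists (r Y)^-1; first by rewrite invr_gt0 expR_gt0.
  exists (r Y *: Y); last by rewrite scalerA mulVf ?scale1r// gt_eqF// expR_gt0.
  by rewrite SE; split => //=; rewrite h_homog rE.
rewrite openE => Y [h0 OY].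
have rY : r X *: X @[X --> Y] --> r Y *: Y.
  exact: (@cvgZ R _ _ (nbhs Y) _ r id (r Y) Y (cr Y h0) cvg_id).
apply: filterI; first exact: near_heval_gt0.
by apply: (rY O); exact: open_nbhs_nbhs.
Qed.

End Cone.

(** Each entry is a finite sum of scaled coordinates, continuous by induction on the list of
    indices. The field is general so as to include [R[i]]. *)
Lemma continuous_mulmx (K : numFieldType) (m n p : nat) (M : 'M[K]_(m, n)) :
  continuous (mulmx M : 'M[K]_(n, p) -> 'M[K]_(m, p)).
Proof.
pose f i j (s : seq 'I_n) (X : 'M[K]_(n, p)) := \sum_(k <- s) M i k * X k j.
have c i j s : continuous (f i j s).
  elim: s => [|k s IHs].
    have -> : f i j [::] = cst 0 by apply/funext => X; rewrite /f big_nil.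
    exact: cst_continuous.
  have -> : f i j (k :: s) = (fun X => M i k * X k j + f i j s X).
    by apply/funext => X; rewrite /f big_cons.
  move=> X.
  have cX := @cvgMl_tmp _ _ _ (@nbhs_filter 'M[K]_(n, p) X) _ (M i k) _
    (@coord_continuous K n p k j X).
  exact: (@cvgD _ _ _ _ (@nbhs_filter 'M[K]_(n, p) X) _ _ _ _ cX (IHs X)).
move=> Z A [P ZP PA].
pose Q i j := (fun X : 'M[K]_(n, p) => (M *m X) i j) @^-1` P i j.
have QZ i j : nbhs Z (Q i j).
  have PZ : nbhs (f i j (index_enum _) Z) (P i j) by have := ZP i j; rewrite mxE.
  have : nbhs Z (f i j (index_enum _) @^-1` P i j) by exact: c PZ.
  by apply: filterS => X; rewrite /Q /= mxE.
have : \forall X \near Z, forall ij, Q ij.1 ij.2 X.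
  exact: (@filter_forall _ _ (fun ij => Q ij.1 ij.2) _
    (@nbhs_filter 'M[K]_(n, p) Z) (fun ij => QZ ij.1 ij.2)).
by apply: filterS => X XQ /=; apply: PA => i j; exact: (XQ (i, j)).
Qed.

(** * Real and imaginary parts of complex vectors, and affine maps *)

Section ComplexVectors.
Local Open Scope complex_scope.
Variables (R : realType) (n : nat).
Implicit Types (Z V W : 'cV[R[i]]_n) (Y v : 'cV[R]_n) (t : R).

Lemma imaginaryE : 'i%R = 0 +i* 1 :> R[i].
Proof. by []. Qed.

Lemma conjE (z : R[i]) : (z^*)%R = complex.Re z -i* complex.Im z.
Proof. by case: z. Qed.

Definition rvec Z : 'cV[R]_n := map_mx (@complex.Re R) Z.
Definition ivec Z : 'cV[R]_n := map_mx (@complex.Im R) Z.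

Lemma ivecD Z W : ivec (Z + W) = ivec Z + ivec W.
Proof. by apply/matrixP => i j; rewrite !mxE; case: (Z i j) (W i j) => ? ? []. Qed.

Lemma rvecD Z W : rvec (Z + W) = rvec Z + rvec W.
Proof. by apply/matrixP => i j; rewrite !mxE; case: (Z i j) (W i j) => ? ? []. Qed.

Lemma ivecZ t Z : ivec (t%:C *: Z) = t *: ivec Z.
Proof.
by apply/matrixP => i j; rewrite !mxE; case: (Z i j) => a b /=; rewrite mul0r addr0.
Qed.

Lemma ivec_line Z V t : ivec (Z + t%:C *: V) = ivec Z + t *: ivec V.
Proof. by rewrite ivecD ivecZ. Qed.

Lemma ivec_real v : ivec (map_mx (real_complex R) v) = 0.
Proof. by apply/matrixP => i j; rewrite !mxE. Qed.

Lemma rvec_real v : rvec (map_mx (real_complex R) v) = v.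
Proof. by apply/matrixP => i j; rewrite !mxE. Qed.

Lemma ivec_mulmx (A : 'M[R]_n) Z : ivec (map_mx (real_complex R) A *m Z) = A *m ivec Z.
Proof.
have ImD (x y : R[i]) : complex.Im (x + y) = complex.Im x + complex.Im y.
  by case: x y => ? ? [].
apply/matrixP => i j; rewrite !mxE (big_morph _ ImD (erefl : complex.Im 0 = 0)).
by apply: eq_bigr => k _; rewrite !mxE; case: (Z k j) => a b /=; rewrite mul0r addr0.
Qed.

Lemma rvec_mulmx (A : 'M[R]_n) Z : rvec (map_mx (real_complex R) A *m Z) = A *m rvec Z.
Proof.
have ReD (x y : R[i]) : complex.Re (x + y) = complex.Re x + complex.Re y.
  by case: x y => ? ? [].
apply/matrixP => i j; rewrite !mxE (big_morph _ ReD (erefl : complex.Re 0 = 0)).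
by apply: eq_bigr => k _; rewrite !mxE; case: (Z k j) => a b /=; rewrite mul0r subr0.
Qed.

Lemma rvec_ivec_inj Z W : rvec Z = rvec W -> ivec Z = ivec W -> Z = W.
Proof.
move=> /matrixP eR /matrixP eI; apply/matrixP => i j.
by move: (eR i j) (eI i j); rewrite !mxE; case: (Z i j) (W i j) => ? ? [? ?] /= -> ->.
Qed.

Lemma ivec_evec (j : 'I_n) : ivec (evec R j) = 0.
Proof.
by apply/matrixP => i k; rewrite !mxE; case: (_ && _).
Qed.

Lemma ivec_ievec (j : 'I_n) : ivec ('i%R *: evec R j) = delta_mx j ord0.
Proof.
apply/matrixP => i k; rewrite !mxE imaginaryE.
by case: (_ && _) => /=; rewrite !(mulr0, mul0r, mulr1, mul1r, addr0, add0r).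
Qed.

(** As |Im z| <= |z|, a real radius serves unchanged as a complex one. *)
Lemma continuous_Im : continuous (fun z : R[i] => complex.Im z : R).
Proof.
move=> z A [e /= e0 eA].
exists e%:C => /=; first by rewrite ltcR.
move=> w /= zw; apply: eA => /=.
move: zw; rewrite /ball_ /= normc_def ltcR; apply: le_lt_trans.
rewrite -sqrtr_sqr ler_sqrt ?addr_ge0 ?sqr_ge0//.
by case: z w => a b [a' b'] /=; rewrite lerDr sqr_ge0.
Qed.

Lemma continuous_ivec : continuous ivec.
Proof.
move=> Z A [P ZP PA].
have ZP' i j : nbhs (Z i j) ((fun z : R[i] => complex.Im z : R) @^-1` P i j).
  by apply: continuous_Im; have := ZP i j; rewrite mxE.
exists (fun i j => (fun z : R[i] => complex.Im z : R) @^-1` P i j) => // W WP.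
by apply: PA => i j; rewrite mxE; exact: WP.
Qed.

Lemma affine_diff (a : affine R n) Z :
  differentiable (aff_act a) Z /\ forall V, 'd (aff_act a) Z V = a.2 *m V.
Proof.
have c : continuous (mulmx a.2 : 'cV[R[i]]_n -> 'cV[R[i]]_n).
  exact: (@continuous_mulmx R[i] n n 1 a.2).
have D1 : differentiable (mulmx a.2 : 'cV[R[i]]_n -> 'cV[R[i]]_n) Z.
  exact: linear_differentiable.
have D2 : differentiable (cst a.1 : 'cV[R[i]]_n -> 'cV[R[i]]_n) Z.
  exact: differentiable_cst.
have E : aff_act a = (mulmx a.2 : 'cV[R[i]]_n -> 'cV[R[i]]_n) + cst a.1 by [].
split; first by rewrite E; exact: differentiableD.
move=> V; rewrite E.
have DD := congr1 (@^~ V) (diffD D1 D2).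
have DL := congr1 (@^~ V) (diff_lin Z c).
have DC := congr1 (@^~ V) (diff_cst a.1 Z).
apply: (etrans DD).
apply: (etrans (congr2 +%R DL DC)).
exact: addr0.
Qed.

End ComplexVectors.

(** * Differentiation of functions of the imaginary part *)

Section TubeCalculus.
Local Open Scope complex_scope.
Variables (R : realType) (n : nat) (C : set 'cV[R]_n).
Hypothesis oC : open C.
Implicit Types (Z V W : 'cV[R[i]]_n) (Y v : 'cV[R]_n).

Lemma near_line Y v : C Y -> \forall t \near (0 : R), C (Y + t *: v).
Proof.
move=> CY.
have c : Y + t *: v @[t --> (0 : R)] --> Y + (0 : R) *: v.
  by apply: cvgD; [exact: cvg_cst|apply: cvgZr_tmp; exact: cvg_id].
have N : nbhs (Y + (0 : R) *: v) C.
  by rewrite scale0r addr0; exact: open_nbhs_nbhs.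
exact: (c C N).
Qed.

(** Agreement over [C] suffices, because a short segment through a point of the open set [C] stays
    in it. *)
Lemma rder_ivec (f : 'cV[R[i]]_n -> R) (a : 'cV[R]_n -> R) V Z :
  (forall Z', C (ivec Z') -> f Z' = a (ivec Z')) -> C (ivec Z) ->
  rder V f Z = 'D_(ivec V) a (ivec Z).
Proof.
move=> fa CZ; rewrite -derive_line /rder !derive1E.
apply: near_eq_derive; apply: filterS (near_line (ivec V) CZ) => t Ct.
by rewrite fa ivec_line.
Qed.

Lemma derivable_ivec (f : 'cV[R[i]]_n -> R) (a : 'cV[R]_n -> R) V Z :
  (forall Z', C (ivec Z') -> f Z' = a (ivec Z')) -> C (ivec Z) ->
  derivable a (ivec Z) (ivec V) ->
  derivable (fun t : R => f (Z + t%:C *: V)) 0 1.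
Proof.
move=> fa CZ /(derivable_line a (ivec V) (ivec Z)).2.
apply: (@near_eq_derivable R R R).
by apply: filterS (near_line (ivec V) CZ) => t Ct; rewrite fa ivec_line.
Qed.

Lemma cder_ivec (F : 'cV[R[i]]_n -> R[i]) (a b : 'cV[R]_n -> R) V Z :
  (forall Z', C (ivec Z') -> F Z' = a (ivec Z') +i* b (ivec Z')) -> C (ivec Z) ->
  cder V F Z = 'D_(ivec V) a (ivec Z) +i* 'D_(ivec V) b (ivec Z).
Proof.
move=> Fab CZ; rewrite /cder.
by congr (_ +i* _); apply: rder_ivec => // Z' CZ'; rewrite Fab.
Qed.

Lemma complex_half (x y : R) : (x +i* y) / 2%:R = (x / 2%:R) +i* (y / 2%:R) :> R[i].
Proof.
have -> : (2%:R : R[i])^-1 = (2%:R^-1 : R)%:C by rewrite fmorphV rmorph_nat.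
by apply/eqP; rewrite eq_complex /= !mulr0 subr0 add0r !eqxx.
Qed.

(** The direction e_j has no imaginary part, so only i e_j counts, and -i (Da + i Db) / 2 = (Db - i
    Da) / 2. *)
Lemma wirtinger_ivec j (F : 'cV[R[i]]_n -> R[i]) (a b : 'cV[R]_n -> R) Z :
  (forall Z', C (ivec Z') -> F Z' = a (ivec Z') +i* b (ivec Z')) -> C (ivec Z) ->
  wirtinger j F Z = ('D_(delta_mx j ord0) b (ivec Z) / 2%:R) +i*
                    (- 'D_(delta_mx j ord0) a (ivec Z) / 2%:R).
Proof.
move=> Fab CZ; rewrite /wirtinger !(cder_ivec _ Fab)// ivec_evec ivec_ievec !derive0.
rewrite -complex_half; congr (_ / _); apply/eqP; rewrite eq_complex imaginaryE /=.
by rewrite !(mul0r, mul1r, sub0r, add0r, addr0, opprK) !eqxx.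
Qed.

Lemma wirtinger_bar_ivec j (F : 'cV[R[i]]_n -> R[i]) (a b : 'cV[R]_n -> R) Z :
  (forall Z', C (ivec Z') -> F Z' = a (ivec Z') +i* b (ivec Z')) -> C (ivec Z) ->
  wirtinger_bar j F Z = (- 'D_(delta_mx j ord0) b (ivec Z) / 2%:R) +i*
                        ('D_(delta_mx j ord0) a (ivec Z) / 2%:R).
Proof.
move=> Fab CZ; rewrite /wirtinger_bar !(cder_ivec _ Fab)// ivec_evec ivec_ievec !derive0.
rewrite -complex_half; congr (_ / _); apply/eqP; rewrite eq_complex imaginaryE /=.
by rewrite !(mul0r, mul1r, sub0r, add0r, addr0) !eqxx.
Qed.

Lemma open_ivec : open [set Z | C (ivec Z)].
Proof. by move/continuousP: (@continuous_ivec R n); exact. Qed.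

Variable h : mpoly.mpoly n R.
Hypothesis h0 : forall Y, C Y -> heval h Y != 0.

Lemma continuous_hquot p k Y : C Y -> {for Y, continuous (hquot h p k)}.
Proof.
move=> CY.
have -> : hquot h p k = (fun X => heval p X * (heval (h ^+ k) X)^-1).
  by apply/funext => X; rewrite /hquot /heval rmorphXn.
have hk0 : heval (h ^+ k) Y != 0 by rewrite /heval rmorphXn expf_neq0// h0.
have c1 := @continuous_heval R n p Y.
have c2 := @cvgV _ _ _ _ _ _ hk0 (@continuous_heval R n (h ^+ k) Y).
exact: (@cvgM _ _ _ _ _ _ _ _ c1 (c2 _)).
Qed.

(** Induction on [k] with numerator, exponent and function all general, since each derivative is
    again such a quotient over [C]. *)
Lemma C_k_hquot k p m (f : 'cV[R[i]]_n -> R) :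
  (forall Z, C (ivec Z) -> f Z = hquot h p m (ivec Z)) ->
  C_k k [set Z | C (ivec Z)] f.
Proof.
have cf q l g : (forall Z, C (ivec Z) -> g Z = hquot h q l (ivec Z)) ->
    forall Z, C (ivec Z) -> {for Z, continuous g}.
  move=> gE Z CZ.
  have c : {for Z, continuous (hquot h q l \o @ivec R n)}.
    by apply: continuous_comp; [exact: continuous_ivec|exact: continuous_hquot].
  have nZ : \forall Z' \near Z, (hquot h q l \o @ivec R n) Z' = g Z'.
    have := open_nbhs_nbhs (conj open_ivec CZ : open_nbhs Z _).
    by apply: filterS => Z' CZ'; rewrite /= gE.
  rewrite /prop_for /continuous_at (gE _ CZ).
  exact: cvg_trans (near_eq_cvg nZ) c.
elim: k p m f => [|k IHk] p m f fE; first by split=> //; exact: cf fE.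
split=> [|V]; first exact: cf fE.
split=> [Z CZ|].
  apply: (derivable_ivec fE CZ).
  by have [] := is_derive_hquot (ivec V) p m (h0 CZ).
apply: IHk => Z CZ; rewrite (rder_ivec _ fE)//.
by have [_ ->] := is_derive_hquot (ivec V) p m (h0 CZ).
Qed.

End TubeCalculus.

(** * Hermitian tensors with real coefficients *)

Section HermitianTensor.
Local Open Scope complex_scope.
Variables (R : realType) (n : nat).
Local Notation toC := (map_mx (real_complex R)).
Implicit Types (V W : 'cV[R[i]]_n) (M : 'M[R]_n).

Lemma conj_real (x : R) : Num.conj (x%:C : R[i]) = x%:C.
Proof. by rewrite conjE /= oppr0. Qed.

Lemma hermitian_tensorE (A : 'M[R[i]]_n) V W :
  hermitian_tensor A V W = (V^T *m A *m map_mx Num.conj W) ord0 ord0.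
Proof.
rewrite /hermitian_tensor -mulmxA mxE; apply: eq_bigr => i _.
rewrite !mxE mulr_sumr; apply: eq_bigr => j _; rewrite !mxE.
by rewrite mulrA [V i _ * _]mulrC.
Qed.

Lemma hermitian_tensor_mulmx M (L : 'M[R]_n) V W :
  hermitian_tensor (toC M) (toC L *m V) (toC L *m W) =
  hermitian_tensor (toC (L^T *m M *m L)) V W.
Proof.
rewrite !hermitian_tensorE; congr (fun_of_matrix _ _ _).
have -> : map_mx Num.conj (toC L *m W) = toC L *m map_mx Num.conj W.
  rewrite map_mxM; congr (_ *m _); apply/matrixP => i j.
  by rewrite !mxE; exact: conj_real.
by rewrite trmx_mul !map_mxM map_trmx !mulmxA.
Qed.

(** As [M] is real, the real and imaginary parts of a kernel vector lie in the real kernel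
    separately. *)
Lemma hermitian_tensor_real_nondeg M V :
  (forall v : 'cV[R]_n, v^T *m M = 0 -> v = 0) ->
  (forall W, hermitian_tensor (toC M) V W = 0) -> V = 0.
Proof.
move=> Mnd VW.
have VM0 : V^T *m toC M = 0.
  apply/matrixP => i j; rewrite (ord1 i) [RHS]mxE.
  have := VW (delta_mx j ord0); rewrite hermitian_tensorE.
  have -> : map_mx Num.conj (delta_mx j ord0 : 'cV[R[i]]_n) = delta_mx j ord0.
    by apply/matrixP => k l; rewrite !mxE conjC_nat.
  by rewrite -colE mxE.
have MV0 : toC M^T *m V = 0 by rewrite -[V]trmxK -map_trmx -trmx_mul VM0 trmx0.
have real0 (v : 'cV[R]_n) : M^T *m v = 0 -> v = 0.
  by move=> Mv; apply: Mnd; rewrite -[M]trmxK -trmx_mul Mv trmx0.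
apply: rvec_ivec_inj.
  have -> : rvec 0 = 0 :> 'cV[R]_n by apply/matrixP => i j; rewrite !mxE.
  apply: real0; rewrite -rvec_mulmx MV0.
  by apply/matrixP => i j; rewrite !mxE.
have -> : ivec 0 = 0 :> 'cV[R]_n by apply/matrixP => i j; rewrite !mxE.
apply: real0; rewrite -ivec_mulmx MV0.
by apply/matrixP => i j; rewrite !mxE.
Qed.

End HermitianTensor.

(** * The metric of the tube domain *)

Section TubeMetric.
Local Open Scope complex_scope.
Variables (R : realType) (n d : nat) (h : mpoly.mpoly n R) (S : set 'cV[R]_n).
Hypothesis oS : open (cone S).
Hypothesis hpos : forall Y, cone S Y -> 0 < heval h Y.
Implicit Types (Z V W : 'cV[R[i]]_n).

(** On functions of Y alone, the mixed Wirtinger derivative is one quarter of the second derivative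
    in Y. *)
Lemma tube_metricE Z : tube S Z ->
  tube_metric d h Z = map_mx (real_complex R) (log_hess_mx d h (ivec Z)).
Proof.
move=> SZ; apply/matrixP => i j; rewrite !mxE.
(* The potential depends on the imaginary part everywhere, so [setT] is used and the formula holds
   at all points, which [funext] requires. *)
have K Z' : wirtinger_bar j (fun Z0 => (kahler_potential d h Z0)%:C) Z' =
    cst 0 (ivec Z') +i* ((2%:R^-1 \*: 'D_(delta_mx j ord0) (log_potential d h)) (ivec Z')).
  rewrite (@wirtinger_bar_ivec _ _ setT openT _ _ (log_potential d h) (cst 0))//.
  by rewrite derive_cst oppr0 mul0r mulrC.
have -> : wirtinger_bar j (fun Z0 => (kahler_potential d h Z0)%:C) = _ := funext K.
have h0 := hpos SZ.
have D := is_derive2_log_potential d (delta_mx i ord0) (delta_mx j ord0) h0.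
rewrite (@wirtinger_ivec _ _ setT openT _ _ (cst 0)
  (2%:R^-1 \*: 'D_(delta_mx j ord0) (log_potential d h)))//.
rewrite derive_cst oppr0 mul0r.
have [D1 E1] := D.
rewrite deriveZ// E1 /GRing.scale /=; congr (_ +i* _).
by field.
Qed.

Lemma tube_metric_pseudo_kahler :
  (forall Y (v : 'cV[R]_n), cone S Y -> v^T *m log_hess_mx d h Y = 0 -> v = 0) ->
  pseudo_kahler (tube S) (tube_metric d h).
Proof.
move=> nd; have h0 Y : cone S Y -> heval h Y != 0 by move=> /hpos/lt0r_neq0.
split.
- exact: (open_ivec oS).
- move=> i j k; split.
    apply: (@C_k_hquot _ _ _ oS _ h0 _ (log_hess_num d h (delta_mx i ord0) (delta_mx j ord0)) 2).
    by move=> Z SZ; rewrite tube_metricE// !mxE.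
  (* The imaginary part vanishes, so it is the quotient with numerator 0. *)
  apply: (@C_k_hquot _ _ _ oS _ h0 _ 0 0) => Z SZ.
  by rewrite tube_metricE// !mxE /= /hquot /heval meval0 mul0r.
- move=> Z SZ i j; rewrite tube_metricE// !mxE log_hessC; exact: esym (conj_real _).
- move=> Z SZ V; rewrite tube_metricE//; apply: hermitian_tensor_real_nondeg => v.
  exact: nd.
- move=> Z SZ i j k.
  (* The entries are real, so both Wirtinger derivatives are -i/2 times a derivative of [log_hess],
     and these agree by [derive_log_hessC]. *)
  have gE a b Z' : cone S (ivec Z') -> tube_metric d h Z' a b =
      log_hess d h (delta_mx a ord0) (delta_mx b ord0) (ivec Z') +i* cst 0 (ivec Z').
    by move=> SZ'; rewrite tube_metricE// !mxE.
  have E1 := @wirtinger_ivec R n (cone S) oS k _ _ _ Z (gE i j) SZ.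
  have E2 := @wirtinger_ivec R n (cone S) oS i _ _ _ Z (gE k j) SZ.
  rewrite derive_cst mul0r in E1; rewrite derive_cst mul0r in E2.
  have D := derive_log_hessC d (delta_mx k ord0) (delta_mx i ord0) (delta_mx j ord0) (h0 _ SZ).
  exact: (etrans E1 (etrans (congr1 (fun x : R => 0 +i* (- x / 2%:R)) D) (esym E2))).
Qed.

(** The real translation [b] disappears from the imaginary part; what remains is the invariance of
    [log_hess] under [L]. *)
Lemma tube_metric_invariant (L : 'M[R]_n) (c : R) (b : 'cV[R]_n) : 0 < c ->
  (forall Y, cone S Y -> cone S (L *m Y)) ->
  (forall Y, cone S Y -> heval h (L *m Y) = c * heval h Y) ->
  forall Z, tube S Z -> forall V W,
  hermitian_tensor
    (tube_metric d h (map_mx (real_complex R) L *m Z + map_mx (real_complex R) b))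
    (map_mx (real_complex R) L *m V) (map_mx (real_complex R) L *m W) =
  hermitian_tensor (tube_metric d h Z) V W.
Proof.
move=> c0 LS hL Z SZ V W.
have imE : ivec (map_mx (real_complex R) L *m Z + map_mx (real_complex R) b) = L *m ivec Z.
  by rewrite ivecD ivec_mulmx ivec_real addr0.
have SLZ : tube S (map_mx (real_complex R) L *m Z + map_mx (real_complex R) b).
  by have := LS _ SZ; rewrite -/(ivec Z) -imE.
rewrite !tube_metricE// imE hermitian_tensor_mulmx; congr hermitian_tensor; congr map_mx.
apply/matrixP => i j; rewrite [RHS]mxE.
rewrite -(log_hess_invariant d oS c0 LS hpos hL _ _ SZ) log_hessE trmx_mul.
by rewrite trmx_delta !mulmxA -colE -!mulmxA -rowE [RHS]mxE [RHS]mxE.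
Qed.

End TubeMetric.

(** * Nondegeneracy along the hypersurface *)

Section Nondegenerate.
Variables (R : realType) (n d : nat) (h : mpoly.mpoly n R) (H : dform R n d).
Variable S : set 'cV[R]_n.
Hypothesis d_ge2 : (2 <= d)%N.
Hypothesis polH : polarization h H.
Implicit Types (X Y v w : 'cV[R]_n).

Let mulH : multilinear H. Proof. by case: polH. Qed.
Let symH : Defs.symmetric_form H. Proof. by case: polH. Qed.
Let hH X : H [ffun=> X] = heval h X. Proof. by case: polH => _ _; exact. Qed.
Let d_gt1 : (d.-1 < d)%N. Proof. by case: d d_ge2. Qed.
Let d_gt2 : (d.-2 < d)%N. Proof. by case: d d_ge2 => [//|[//|k]] _ /=; rewrite ltnS leqnSn. Qed.
(** The last slot, and [k1] the one before it: the places where [canonical_metric] puts its second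
    and first argument. *)
Let k0 := Ordinal d_gt1.
Let k1 := Ordinal d_gt2.
Let k10 : k1 != k0.
Proof. by rewrite -val_eqE /=; case: d d_ge2 => [//|[//|k]] _ /=; rewrite neq_ltn ltnSn. Qed.

Lemma canonical_metricE X v w :
  d%:R * canonical_metric H X v w = - heval (dirderiv v (dirderiv w h)) X.
Proof.
rewrite (heval_dirderiv2 mulH symH hH _ _ _ k10) /canonical_metric.
have eq2 (m : nat) : (m.+2 == d) = (m == d.-2).
  by case: d d_ge2 => [//|[//|e]] _ /=; rewrite !eqSS.
have eq1 (m : nat) : (m.+1 == d) = (m == d.-1).
  by case: d d_ge2 => [//|e] _ /=; rewrite eqSS.
rewrite mulNr mulrN mulrA -natrM; congr (- (_ * H _)).
apply/ffunP => k; rewrite !ffunE -!val_eqE /=.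
by rewrite eq2 eq1.
Qed.

Lemma euler1 X : heval (dirderiv X h) X = d%:R * heval h X.
Proof.
rewrite (heval_dirderiv1 mulH symH hH k0) -hH; congr (_ * H _).
by apply/ffunP => k; rewrite !ffunE; case: eqP.
Qed.

(** Here [X] is also a fixed direction: both sides are d (d - 1) H(X, ..., X, v), up to the position
    of [v]. *)
Lemma euler2 X v :
  heval (dirderiv v (dirderiv X h)) X = d.-1%:R * heval (dirderiv v h) X.
Proof.
rewrite (heval_dirderiv2 mulH symH hH _ _ _ k10).
rewrite (heval_dirderiv1 mulH symH hH k1) mulrA -natrM mulnC; congr (_ * H _).
by apply/ffunP => k; rewrite !ffunE; case: eqP => //; case: eqP.
Qed.

Hypothesis hS : forall X, S X -> heval h X = 1.
Hypothesis prS : pseudo_riemannian h H S.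

Lemma log_hess_nondeg X v : S X -> (forall w, log_hess d h v w X = 0) -> v = 0.
Proof.
move=> SX v0.
have dN0 : d%:R != 0 :> R by rewrite pnatr_eq0 -lt0n (leq_trans _ d_ge2).
(* Where [h] is 1, the vanishing of [log_hess] equates the second derivative with the product of the
   first ones. *)
have v1 w : heval (dirderiv v (dirderiv w h)) X =
            heval (dirderiv w h) X * heval (dirderiv v h) X.
  have := v0 w; rewrite /log_hess /hquot (hS SX) expr1n divr1 /log_hess_num.
  rewrite /heval mevalZ mevalB !mevalM -!/(heval _ _) (hS SX) mulr1 => /eqP.
  by rewrite mulf_eq0 oppr_eq0 invr_eq0 (negbTE dN0) subr_eq0 => /eqP.
(* Taking [w] to be [X], the Euler identities give (d - 1) D_v h = d D_v h. *)
have tv : heval (dirderiv v h) X = 0.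
  have := v1 X; rewrite euler1 euler2 (hS SX) mulr1 => /eqP.
  rewrite -subr_eq0 -mulrBl mulf_eq0 => /orP[|/eqP//].
  rewrite -[in X in _ - X](ltn_predK d_ge2) -[d.-1.+1]addn1 natrD opprD addrA subrr sub0r.
  by rewrite oppr_eq0 oner_eq0.
apply: (prS SX); first by rewrite /tangent_space /= diff_heval.
move=> w _; apply: (mulfI dN0).
by rewrite canonical_metricE v1 tv !mulr0 oppr0.
Qed.

End Nondegenerate.

(** * The action of the extended group on the tube domain *)

Section Main.
Variables (R : realType) (n d : nat) (h : mpoly.mpoly n R) (H : dform R n d).
Variables (S : set 'cV[R]_n) (G : set 'M[R]_n).
Hypothesis d_ge2 : (2 <= d)%N.
Hypothesis hypS : hypersurface d h S.
Hypothesis polH : polarization h H.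
Hypothesis prS : pseudo_riemannian h H S.
Hypothesis subG : GL_subgroup G.
Hypothesis homS : homogeneous_under G S.
Implicit Types (X Y v w : 'cV[R]_n) (A : 'M[R]_n).
Local Notation toC := (map_mx (real_complex R)).

Let h_homog (t : R) X : heval h (t *: X) = t ^+ d * heval h X.
Proof. by case: polH => mH _ hH; exact: (heval_homog mH hH). Qed.

Let hS X : S X -> heval h X = 1.
Proof. by case: hypS => _ _ [U _ ->] _ _ []. Qed.

Let d_gt0 : (0 < d)%N. Proof. exact: leq_trans d_ge2. Qed.

Let oS : open (cone S).
Proof. by case: hypS => _ _ [U oU SE] _ _; exact: (open_cone d_gt0 h_homog hS oU SE). Qed.

Let hpos Y : cone S Y -> 0 < heval h Y.
Proof. exact: (cone_heval_gt0 h_homog hS). Qed.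

Let GS A X : G A -> S X -> S (A *m X).
Proof. by move=> GA SX; case: homS => /(_ A GA) <- _; exists X. Qed.

Lemma cone_stable A (t : R) Y : G A -> 0 < t -> cone S Y -> cone S (t *: A *m Y).
Proof.
move=> GA t0 [s s0 [X SX ->]]; exists (t * s); first exact: mulr_gt0.
by exists (A *m X); [exact: GS|rewrite -scalemxAl -scalemxAr scalerA].
Qed.

(** [G] preserves [S], where [h] is constantly 1; homogeneity carries the invariance of [h] to the
    cone, and only there. *)
Lemma heval_stable A (t : R) Y : G A -> cone S Y ->
  heval h (t *: A *m Y) = t ^+ d * heval h Y.
Proof.
move=> GA [s s0 [X SX ->]].
by rewrite -scalemxAl h_homog -scalemxAr !h_homog !hS//; exact: GS.
Qed.

(** Dilations preserve [log_hess], so nondegeneracy spreads from [S] along the rays. *)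
Lemma log_hess_mx_nondeg Y v : cone S Y -> v^T *m log_hess_mx d h Y = 0 -> v = 0.
Proof.
move=> [t t0 [X SX ->]] v0.
have tN0 : t != 0 by rewrite gt_eqF.
(* The dilation by [t] takes [X] to the given point and [t^-1 *: v] to [v]. *)
suff : t^-1 *: v = 0 by move/eqP; rewrite scaler_eq0 invr_eq0 (negbTE tN0) => /eqP.
apply: (log_hess_nondeg d_ge2 polH hS prS SX) => w.
have G1 : G 1%:M by case: subG.
have td0 : 0 < t ^+ d by exact: exprn_gt0.
rewrite -(log_hess_invariant d oS td0 (fun Y => @cone_stable _ t Y G1 t0) hpos
  (fun Y => @heval_stable _ t Y G1) _ _ (sub_cone SX)).
rewrite -!scalemxAl !mul1mx scalerA mulfV// scale1r.
by rewrite log_hessE v0 mul0mx mxE.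
Qed.

(** This makes [hat_group] a faithful copy of the parameter set, with [t] recovered from h(t A X) =
    t^d at a point [X] of [S]. *)
Lemma hat_elt_inj : set_inj (hat_param G) (@hat_elt R n).
Proof.
have toC_inj p q : injective (map_mx (real_complex R) : 'M[R]_(p, q) -> _).
  by move=> A B /matrixP AB; apply/matrixP => i j; have := AB i j; rewrite !mxE => -[].
have [_ [X SX] _ _ _] := hypS.
move=> [b [t A]] [b' [t' A']] /set_mem[/= t0 GA] /set_mem[/= t'0 GA'] [/toC_inj -> E].
have {}E : t *: A = t' *: A' by apply: toC_inj; rewrite !map_mxZ.
have tt' : t = t'.
  have := congr1 (fun B => heval h (B *m X)) E.
  rewrite -!scalemxAl !h_homog !hS ?mulr1; [|exact: GS|exact: GS].
  by apply: pexpIrn => //; rewrite ?nnegrE ltW.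
congr (_, _); rewrite -tt' in E *; congr (_, _).
by apply: (scalerI _ E); rewrite gt_eqF.
Qed.

Lemma aff_act_hat (b : 'cV[R]_n) (t : R) A Z :
  aff_act (hat_elt (b, (t, A))) Z = toC (t *: A) *m Z + toC b.
Proof. by rewrite /aff_act /hat_elt /= map_mxZ. Qed.

Lemma ivec_aff_act (b : 'cV[R]_n) (t : R) A Z :
  ivec (aff_act (hat_elt (b, (t, A))) Z) = t *: A *m ivec Z.
Proof. by rewrite aff_act_hat ivecD ivec_mulmx ivec_real addr0. Qed.

Lemma hat_group_subgroup : aff_subgroup (hat_group G).
Proof.
have [Gu G1 GM GV] := subG.
split.
- move=> _ [[b [t A]] [/= t0 GA] <-] /=.
  rewrite -map_mxZ map_unitmx unitmxZ ?unitfE ?gt_eqF//; exact: Gu.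
- exists (0, (1, 1%:M)); first by split.
  by rewrite /hat_elt /= map_mx0 scale1r map_mx1.
- move=> _ _ [[b [t A]] [/= t0 GA] <-] [[b' [t' A']] [/= t'0 GA'] <-] /=.
  (* The product in the semidirect product: the linear part of the first factor acts on the
     translation of the second. *)
  exists (b + t *: A *m b', (t * t', A *m A')).
    by split => /=; [exact: mulr_gt0|exact: GM].
  rewrite /hat_elt /= -!map_mxZ -!map_mxM -map_mxD; congr (_, map_mx _ _).
  by rewrite -scalemxAl -scalemxAr scalerA.
- move=> _ [[b [t A]] [/= t0 GA] <-] /=.
  exists (- (t^-1 *: invmx A *m b), (t^-1, invmx A)).
    by split => /=; [rewrite invr_gt0|exact: GV].
  have tA : t *: A \in unitmx by rewrite unitmxZ ?unitfE ?gt_eqF//; exact: Gu.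
  by rewrite /hat_elt /= -!map_mxZ -map_invmx -map_mxM -map_mxN invmxZ.
Qed.

Lemma tube_pseudo_kahler : pseudo_kahler (tube S) (tube_metric d h).
Proof. exact: (tube_metric_pseudo_kahler oS hpos log_hess_mx_nondeg). Qed.

Lemma hat_group_isometry a : hat_group G a ->
  holomorphic_isometry (tube S) (tube_metric d h) (aff_act a).
Proof.
move=> Ga; have [Lu L1 LM LV] := hat_group_subgroup.
have UU c : hat_group G c -> forall Z, tube S Z -> tube S (aff_act c Z).
  move=> [[b [t A]] [/= t0 GA] <-] Z SZ.
  by rewrite /tube /= -/(ivec _) ivec_aff_act; exact: cone_stable.
have ua := Lu _ Ga.
split.
- split.
  + exact: UU.
  + move=> Z W _ _ /addIr E.
    by rewrite -(mulKmx ua Z) E mulKmx.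
  (* Surjectivity onto the tube uses that the inverse belongs to the group and so preserves the
     tube. *)
  + move=> W SW; exists (aff_act (- (invmx a.2 *m a.1), invmx a.2) W).
      by apply: UU => //; exact: LV.
    by rewrite /aff_act /= mulmxDr mulmxN !mulmxA mulmxV// !mul1mx addrNK.
- by move=> Z _; have [] := affine_diff a Z.
move=> Z SZ V W; have [_ dE] := affine_diff a Z.
rewrite !dE {dE UU ua}; case: Ga => -[b [t A]] [/= t0 GA] <- /=.
rewrite aff_act_hat -map_mxZ.
apply: (tube_metric_invariant d oS hpos b (exprn_gt0 d t0)) => // Y SY.
  exact: cone_stable.
exact: heval_stable.
Qed.

Lemma hat_group_transitive Z W : tube S Z -> tube S W ->
  exists2 a, hat_group G a & aff_act a Z = W.
Proof.
move=> [t t0 [X SX ZE]] [s s0 [X' SX' WE]].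
have [_ /(_ X X' SX SX')[A GA AX]] := homS.
have st0 : 0 < s / t by exact: divr_gt0.
(* The linear part already matches imaginary parts, sending [t *: X] to [s *: X']; the translation
   corrects the real parts. *)
pose b := rvec W - s / t *: A *m rvec Z.
exists (hat_elt (b, (s / t, A))); first by exists (b, (s / t, A)).
apply: rvec_ivec_inj.
  by rewrite aff_act_hat rvecD rvec_mulmx rvec_real addrC subrK.
rewrite ivec_aff_act /ivec ZE WE -scalemxAl -scalemxAr AX scalerA.
by rewrite divfK// gt_eqF.
Qed.

End Main.

Theorem corollary1p3 (R : realType) (n d : nat) (h : mpoly.mpoly n R)
    (H : dform R n d) (S : set 'cV[R]_n) (G : set 'M[R]_n)
    (d_ge2 : (2 <= d)%N)
    (hypS : hypersurface d h S)
    (polH : polarization h H)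
    (prS : pseudo_riemannian h H S)
    (subG : GL_subgroup G)
    (homS : homogeneous_under G S) :
  set_inj (hat_param G) (@hat_elt R n) /\
  homogeneous_pseudo_kahler (tube S) (tube_metric d h) (hat_group G).
Proof.
split; first exact: (hat_elt_inj d_ge2 hypS polH homS).
split.
- exact: (tube_pseudo_kahler d_ge2 hypS polH prS subG homS).
- exact: hat_group_subgroup.
- exact: (hat_group_isometry d_ge2 hypS polH subG homS).
- exact: hat_group_transitive.
Qed.
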